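(* Let $P$ be a set of prime numbers such that $\sum_{p\in P} 1/\sqrt{p} < \infty$. Then there exist numbers $\alpha \in \mathbb{R}\setminus\mathbb{Z}$, $\alpha>1$, such that for $G = P\cup\{\alpha\}$ the Beurling integers $b_0=1\le b_1\le b_2\le\dots$ generated by $G$ satisfy $b_{i+1}-b_i \ge 1$ for all $i$. Moreover, the set of such numbers $\alpha$ has positive Lebesgue measure.
   Context: For a sequence $G=\{g_1,g_2,\dots\}$ of real numbers with $1<g_1\le g_2\le\dots$ (the generators), the associated Beurling integers are the sequence $B=\{b_0,b_1,b_2,\dots\}$, $b_0=1\le b_1\le b_2\le\dots$, consisting of all finite products of elements of $G$ (repetitions of factors allowed, the empty product being $1$), listed in nondecreasing order with multiplicity. *)

(* Defs.v *)
From mathcomp Require Import all_boot all_order all_algebra finmap multiset.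
From mathcomp Require Import all_classical all_reals all_analysis.

Set Implicit Arguments.
Unset Strict Implicit.
Unset Printing Implicit Defensive.

Import Order.TTheory GRing.Theory Num.Theory.

Local Open Scope classical_set_scope.
Local Open Scope mset_scope.
Local Open Scope ring_scope.

(* A finite product of elements of [G] is indexed by the finite multiset [m] of
   its factors ([mset0] gives the empty product 1).  Two different multisets
   with the same product are listed separately: this is the multiplicity of
   that value in the sequence. *)
Definition beurling_integers (R : realType) (G : set R) (b : nat -> R) : Prop :=
  nondecreasing_seq b /\
  exists f : nat -> {mset R},
    set_bij [set: nat] [set m : {mset R} | forall x, x \in m -> G x] f /\
    forall i, b i = \prod_(x <- f i) x.

(* [P] being a set of primes and [a] a non-integer, no element is repeated in
   the union, so it can be taken as a plain set of generators. *)
Definition generators (R : realType) (P : set nat) (a : R) : set R :=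
  [set p%:R | p in P] `|` [set a].

Definition gap_numbers (R : realType) (P : set nat) : set R :=
  [set a : R | a \isn't a Num.int /\ 1 < a /\
    exists b : nat -> R, beurling_integers (generators P a) b /\
      forall i, 1 <= b i.+1 - b i].

(* Main.v *)
(* By an Euler product, the sum of n^(-1/2) over the integers n with all prime
   factors in P is bounded by some C.  A non-integer a > 1 is a gap number iff
   |n a^j - m| >= 1 for all j >= 1 and all such n, m.  On the window
   [2q^2, 4q^2] the set of a violating this for given (j+1, n, m) has diameter
   at most 2 / (n (2q^2)^j), and is empty unless m <= X := 16 q^2 n (4q^2)^j;
   bounding the indicator of m <= X by (X/m)^(1/2), its measure is at most
   16 q^(1-j) n^(-1/2) m^(-1/2).  The sum over all (j, n, m) is at most
   32 q C^2, less than the length 2q^2 of the window once q > 16 C^2. *)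
Require Import Defs.
From mathcomp Require Import all_boot all_order all_algebra finmap multiset.
From mathcomp Require Import all_classical all_reals all_analysis.
From mathcomp Require Import zify ring lra.

Import Order.TTheory GRing.Theory Num.Theory.

Local Open Scope classical_set_scope.
Local Open Scope ring_scope.

(** * Listing a set with gaps in increasing order *)

(** Iterate the map sending [N] to the least element of [K] that is at least [N]. Minimality leaves
    no element of [K] strictly between consecutive values. *)
Lemma unbounded_nat_enumeration (K : set nat) :
    (forall N, exists k, K k /\ (N <= k)%N) ->
  exists g : nat -> nat, [/\ forall i, K (g i), forall i, (g i < g i.+1)%N &
    forall k, K k -> exists i, g i = k].
Proof.
move=> Kub.
have /choice[next nextP] : forall N, exists k, [/\ K k, (N <= k)%N &
    forall l, K l -> (N <= l)%N -> (k <= l)%N].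
  move=> N; have exN : exists k, `[< K k /\ (N <= k)%N >].
    by have [k ?] := Kub N; exists k; apply/asboolP.
  case: (ex_minnP exN) => k /asboolP[Kk Nk] kmin; exists k; split=> // l Kl Nl.
  by apply: kmin; apply/asboolP.
pose g := fix g i := if i is j.+1 then next (g j).+1 else next 0%N.
have gK i : K (g i).
  by case: i => [|i] /=; [have [] := nextP 0%N|have [] := nextP (g i).+1].
have gS i : (g i < g i.+1)%N by have [] := nextP (g i).+1.
exists g; split=> // k Kk.
(* This growth guarantees that [g] eventually passes [k]; induction on the index where it does so
   then locates [k]. *)
have gi i : (i <= g i)%N by elim: i => // i IH; apply: leq_ltn_trans IH (gS i).
have [i] : exists i, (k < g i)%N by exists k.+1; exact: gi.
elim: i => [|i IH] kg.
  by have [_ _ kmin] := nextP 0%N; move: (kmin k Kk (leq0n k)); rewrite leqNgt kg.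
case: (ltngtP k (g i)) => [/IH//|gk|->]; last by exists i.
by have [_ _ kmin] := nextP (g i).+1; move: (kmin k Kk gk); rewrite leqNgt kg.
Qed.

(* The gaps make [truncn \o v] injective, so that [S] inherits the order type of
   a set of natural numbers. *)
Lemma gapped_enumeration (R : realType) (T : choiceType) (S : set T)
    (v : T -> R) :
    (forall x, S x -> 0 <= v x) ->
    (forall x y, S x -> S y -> x <> y -> 1 <= `|v x - v y|) ->
    (forall N, exists x, S x /\ N%:R <= v x) ->
  exists f : nat -> T, set_bij [set: nat] S f /\ nondecreasing_seq (v \o f).
Proof.
move=> v0 vgap vub; pose K := [set Num.truncn (v x) | x in S].
have truncI x y : S x -> S y -> Num.truncn (v x) = Num.truncn (v y) -> x = y.
  move=> Sx Sy exy; apply: contrapT => /(vgap x y Sx Sy).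
  have := truncn_itv (v0 _ Sx); have := truncn_itv (v0 _ Sy).
  by rewrite exy -natr1; set t := (Num.truncn _)%:R; case: ger0P => ?; lra.
have [|g [gK gS gsurj]] := unbounded_nat_enumeration K.
  move=> N; have [x [Sx Nx]] := vub N; exists (Num.truncn (v x)).
  by split; [exists x|rewrite truncn_ge_nat ?v0].
have /choice[f fP] : forall i, exists x, S x /\ Num.truncn (v x) = g i.
  by move=> i; have [x Sx xg] := gK i; exists x.
have g_mono i j : (i < j)%N -> (g i < g j)%N.
  elim: j => // j IH; rewrite ltnS leq_eqVlt => /orP[/eqP->//|/IH gij].
  exact: ltn_trans gij (gS j).
exists f; split.
  split=> [i _|i j _ _ fij|x Sx]; first by have [] := fP i.
    have gij : g i = g j by rewrite -(proj2 (fP i)) -(proj2 (fP j)) fij.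
    by case: (ltngtP i j) => // /g_mono; rewrite gij ltnn.
  have [|i gi] := gsurj (Num.truncn (v x)); first by exists x.
  by exists i => //; have [Sfi fi] := fP i; apply: truncI => //; rewrite fi.
apply/nondecreasing_seqP => i /=.
have [[Si ti] [Sj tj]] := (fP i, fP i.+1); rewrite leNgt; apply/negP => /ltW.
by move=> /le_truncn; rewrite ti tj leqNgt gS.
Qed.

(** * Gap numbers characterized by inequalities between integers over [P] *)

Definition integer_over (P : set nat) (n : nat) :=
  (0 < n)%N /\ forall p, prime p -> (p %| n)%N -> P p.

Lemma integer_over1 P : integer_over P 1.
Proof. by split=> // p p_pr; rewrite dvdn1 => /eqP p1; rewrite p1 in p_pr. Qed.

Lemma integer_over_factors P n : integer_over P n ->
  exists s : seq nat, (forall p, p \in s -> P p) /\ (\prod_(p <- s) p)%N = n.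
Proof.
have [k] := ubnP n; elim: k n => // k IH n ltnk [n0 nP].
have [n1|n_gt1] := leqP n 1.
  by exists [::]; split=> //; rewrite big_nil; apply/eqP; rewrite eqn_leq n0 n1.
have pr := pdiv_prime n_gt1; have dv := pdiv_dvd n.
have [||s [sP sE]] := IH (n %/ pdiv n)%N.
- by apply: leq_trans (ltn_Pdiv (prime_gt1 pr) n0) _.
- split=> [|p p_pr pd]; first by rewrite divn_gt0 ?prime_gt0 // dvdn_leq.
  by apply: nP => //; apply: dvdn_trans pd (dvdn_div dv).
exists (pdiv n :: s); split; last by rewrite big_cons sE mulnC divnK.
by move=> p; rewrite inE => /orP[/eqP->|/sP//]; apply: nP.
Qed.

(** Being no integer, [a] differs from every prime, so its occurrences can be counted apart. The
    last clause lets the multiset of factors be recovered from [n] and the exponent of [a]. *)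
Lemma prod_generators (R : realType) (P : set nat) (a : R) (s : seq R) :
    (forall p, P p -> prime p) -> a \isn't a Num.int ->
    (forall x, x \in s -> generators P a x) ->
  exists n, [/\ integer_over P n,
    \prod_(x <- s) x = n%:R * a ^+ count_mem a s &
    forall p, prime p -> count_mem (p%:R : R) s = logn p n].
Proof.
move=> Ppr aZ; have aN k : (a == k%:R) = false.
  by apply/eqP => ak; move: aZ; rewrite ak natr_int.
elim: s => [_|x s IH sG].
  exists 1%N; split; first exact: integer_over1.
    by rewrite big_nil expr0 mulr1.
  by move=> p _; rewrite logn1.
have [|n [[n0 nP] prodE cntE]] := IH; first by move=> y ys; apply: sG; rewrite inE ys orbT.
have [[p Pp /= px]|/= xa] : generators P a x by apply: sG; rewrite mem_head.
  have p_pr := Ppr p Pp.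
  exists (p * n)%N; split.
  - split=> [|q q_pr]; first by rewrite muln_gt0 prime_gt0.
    rewrite Euclid_dvdM // => /orP[|/nP]; last exact.
    by rewrite dvdn_prime2 // => /eqP->.
  - rewrite big_cons /= prodE -px natrM mulrA.
    by rewrite [_ == a]eq_sym aN.
  - move=> q q_pr; rewrite /= cntE // lognM ?(prime_gt0 p_pr) // -px eqr_nat.
    by rewrite (logn_prime _ p_pr) eq_sym.
exists n; split=> //.
- by rewrite big_cons /= prodE xa eqxx exprD expr1 mulrCA.
- by move=> p p_pr; rewrite /= xa aN cntE.
Qed.

Lemma prod_seq_mset (R : realType) (s : seq R) :
  \prod_(x <- seq_mset s) x = \prod_(x <- s) x.
Proof. exact: perm_big (perm_eq_seq_mset s). Qed.

(** Only exponents [j.+1] occur: for exponent 0 the gap is that between distinct integers. *)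
Definition power_gaps {R : realType} (P : set nat) (a : R) :=
  forall j n m, integer_over P n -> integer_over P m ->
    1 <= `|n%:R * a ^+ j.+1 - m%:R|.

Section PowerGaps.
Context {R : realType} {P : set nat} (P_prime : forall p, P p -> prime p).
Implicit Type a : R.

(** Both numbers are terms of [b]. Their indices differ because only one of the two multisets of
    factors contains [a], and terms at different indices are at least 1 apart. *)
Lemma gap_power_gaps a : gap_numbers P a -> power_gaps P a.
Proof.
move=> [aZ [a1 [b [[b_nd [f [[fS _ fsurj] bE]]] bgap]]]] j n m Pn Pm.
have bgap_lt i i' : (i < i')%N -> 1 <= `|b i - b i'|.
  move=> ii'; have le : b i.+1 <= b i' by exact: b_nd.
  by have gap := bgap i; rewrite ler0_norm; lra.
have bgap_neq i i' : i <> i' -> 1 <= `|b i - b i'|.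
  by case: (ltngtP i i') => // /bgap_lt //; rewrite distrC.
have [s [sP sn]] := integer_over_factors _ _ Pn.
have [t [tP tm]] := integer_over_factors _ _ Pm.
pose u := nseq j.+1 a ++ [seq (p%:R : R) | p <- s].
pose w := [seq (p%:R : R) | p <- t].
have [|i _ fi] := fsurj (seq_mset u).
  move=> x; rewrite (perm_mem (perm_eq_seq_mset u)) mem_cat => /orP[|/mapP[p ps ->]].
    by rewrite mem_nseq => /andP[_ /eqP->]; right.
  by left; exists p => //; exact: sP.
have [|i' _ fi'] := fsurj (seq_mset w).
  move=> x; rewrite (perm_mem (perm_eq_seq_mset w)) => /mapP[p pt ->].
  by left; exists p => //; exact: tP.
have bi : b i = n%:R * a ^+ j.+1.
  rewrite bE fi prod_seq_mset big_cat /= big_map -natr_prod sn.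
  by rewrite -[a :: _]/(nseq j.+1 a) big_nseq iter_mulr_1 mulrC.
have bi' : b i' = m%:R by rewrite bE fi' prod_seq_mset big_map -natr_prod tm.
rewrite -bi -bi'; apply: bgap_neq => ii'.
have : a \in w.
  rewrite -(perm_mem (perm_eq_seq_mset w)) -fi' -ii' fi.
  by rewrite (perm_mem (perm_eq_seq_mset u)) mem_head.
by case/mapP => p _ ap; move: aZ; rewrite ap natr_int.
Qed.

Lemma power_gaps_distr a (j k n m : nat) : 1 < a -> power_gaps P a ->
    integer_over P n -> integer_over P m -> (j, n) <> (k, m) ->
  1 <= `|n%:R * a ^+ j - m%:R * a ^+ k|.
Proof.
move=> a1 ga; wlog jk : j k n m / (k <= j)%N => [H|].
  case/orP: (leq_total k j) => kj Pn Pm neq; first exact: H.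
  by rewrite distrC; apply: (H k j m n) => // -[ejk enm]; apply: neq; rewrite ejk enm.
move=> Pn Pm neq; have ak : 1 <= a ^+ k by rewrite exprn_ege1 // ltW.
rewrite -(subnK jk) exprD mulrA -mulrBl normrM (ger0_norm (le_trans ler01 ak)).
suff : 1 <= `|n%:R * a ^+ (j - k) - m%:R| by nra.
case ejk: (j - k)%N => [|i]; last exact: ga.
have kj : k = j by lia.
rewrite expr0 mulr1; have nm : n <> m by move=> nm; apply: neq; rewrite kj nm.
case: (ltngtP n m) => // [nm'|nm'].
  have : (n.+1%:R : R) <= m%:R by rewrite ler_nat.
  by rewrite -natr1 => le; rewrite ler0_norm; lra.
have : (m.+1%:R : R) <= n%:R by rewrite ler_nat.
by rewrite -natr1 => le; rewrite ger0_norm; lra.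
Qed.

Lemma power_gaps_gap a : a \isn't a Num.int -> 1 < a -> power_gaps P a ->
  gap_numbers P a.
Proof.
move=> aZ a1 ga; split=> //; split=> //.
pose S := [set m : {mset R}%mset | forall x, x \in m -> generators P a x].
pose v (m : {mset R}%mset) := \prod_(x <- m) x.
have repr m : S m -> exists n, [/\ integer_over P n, v m = n%:R * a ^+ m a &
    forall p, prime p -> m p%:R = logn p n].
  move=> Sm; have [n [Pn vE cnt]] := prod_generators _ _ _ _ P_prime aZ Sm.
  by exists n; split=> [//||p /cnt <-]; rewrite /v ?vE count_mem_mset.
have v0 m : S m -> 0 <= v m.
  move=> /repr[n [_ -> _]]; rewrite mulr_ge0 // exprn_ge0 //; lra.
have vgap m m' : S m -> S m' -> m <> m' -> 1 <= `|v m - v m'|.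
  move=> Sm Sm' mm'.
  have [[n [Pn -> nE]] [n' [Pn' -> nE']]] := (repr m Sm, repr m' Sm').
  (* Unique factorization: equal exponents of [a] and equal integer parts force equal multiplicities
     at [a] and at each prime of [P]; all other multiplicities vanish. *)
  apply: power_gaps_distr => // -[ej en]; apply: mm'; apply/msetP => x.
  have [->//|xa] := eqVneq x a.
  have [[p Pp <-]|nx] := pselect ([set p%:R | p in P] x).
    by rewrite nE ?nE' ?en //; exact: P_prime.
  have out M : S M -> M x = 0%N.
    move=> SM; apply/mset_eq0P/negP => /SM[//|/= xa'].
    by rewrite xa' eqxx in xa.
  by rewrite !out.
have vub N : exists m, S m /\ N%:R <= v m.
  exists (seq_mset (nseq N a)); split.
    move=> x; rewrite (perm_mem (perm_eq_seq_mset _)) mem_nseq.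
    by case/andP => _ /eqP->; right.
  rewrite /v prod_seq_mset big_nseq iter_mulr_1.
  (* The inequality for [a ^+ 1] and [n = m = 1] reads [1 <= a - 1]; hence the powers of [a] are
     unbounded. *)
  have a2 : 2 <= a.
    have := ga 0%N 1%N 1%N (integer_over1 _) (integer_over1 _).
    by rewrite mul1r expr1 ger0_norm ?subr_ge0 ?(ltW a1) //; lra.
  apply: (@le_trans _ _ (2 ^+ N)); last by rewrite lerXn2r // nnegrE; lra.
  by rewrite -natrX ler_nat ltnW // ltn_expl.
have [f [fbij fnd]] := gapped_enumeration _ _ S v v0 vgap vub.
exists (v \o f); split; first by split=> //; exists f; split.
move=> i /=; have [fS finj _] := fbij.
have le : v (f i) <= v (f i.+1) by exact: fnd.
have -> : v (f i.+1) - v (f i) = `|v (f i) - v (f i.+1)|.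
  by rewrite ler0_norm ?opprB // subr_le0.
apply: vgap; [exact: fS|exact: fS|move=> fi].
by have := finj i i.+1 (in_setT _) (in_setT _) fi; lia.
Qed.

Lemma gap_numbersE : gap_numbers P =
  [set a : R | a \isn't a Num.int /\ 1 < a /\ power_gaps P a].
Proof.
apply/seteqP; split=> a; last by case=> aZ [a1 ga]; exact: power_gaps_gap.
by move=> ga; have := gap_power_gaps _ ga; case: ga => aZ [a1 _].
Qed.

End PowerGaps.

(** * The Euler product bound for the sum of inverse square roots *)

Definition invsqrt_on {R : realType} (A : set nat) (n : nat) : R :=
  if `[< A n >] then (Num.sqrt n%:R)^-1 else 0.

Lemma invsqrt_on_ge0 (R : realType) A n : 0 <= invsqrt_on A n :> R.
Proof. by rewrite /invsqrt_on; case: ifP => // _; rewrite invr_ge0 sqrtr_ge0. Qed.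

Lemma invsqrt_onT (R : realType) (A : set nat) n : A n ->
  invsqrt_on A n = (Num.sqrt n%:R)^-1 :> R.
Proof. by move=> An; rewrite /invsqrt_on asboolT. Qed.

Lemma invsqrt_onF (R : realType) (A : set nat) n : ~ A n ->
  invsqrt_on A n = 0 :> R.
Proof. by move=> An; rewrite /invsqrt_on asboolF. Qed.

Lemma invsqrt_on_le_esum (R : realType) (P : set nat) k :
  ((\sum_(0 <= i < k) invsqrt_on P i : R)%:E <=
     \esum_(p in P) ((Num.sqrt (p%:R : R))^-1)%:E)%E.
Proof.
have -> : \esum_(p in P) ((Num.sqrt (p%:R : R))^-1)%:E =
    \esum_(p in [set x | predT x]) (invsqrt_on P p : R)%:E.
  rewrite (esum_mkcond P) (_ : [set x | predT x] = setT); last exact/seteqP.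
  congr esum; apply/funext => p.
  by rewrite /invsqrt_on; case: (asboolP (P p)) => Pp; [rewrite mem_set|rewrite memNset].
rewrite -nneseries_esum => [|p _]; last by rewrite lee_fin invsqrt_on_ge0.
rewrite -sumEFin; apply: nneseries_lim_ge => p _ _.
by rewrite lee_fin invsqrt_on_ge0.
Qed.

Section IntegersOverSum.
Context {R : realType} {P : set nat} (P_prime : forall p, P p -> prime p).

Let below k : set nat := P `&` [set p | (p < k)%N].
Let S k N : R := \sum_(0 <= n < N) invsqrt_on (integer_over (below k)) n.

(* An integer over [below k.+1] is either over [below k] or [k] times an integer
   over [below k.+1]: this peels off one Euler factor. *)
Lemma invsqrt_on_peel k n N : (n < N)%N ->
  invsqrt_on (integer_over (below k.+1)) n <=
  invsqrt_on (integer_over (below k)) n +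
  \sum_(0 <= m < N) (if n == (k * m)%N then
    invsqrt_on P k * invsqrt_on (integer_over (below k.+1)) m else 0) :> R.
Proof.
move=> nN; set T := \sum_(0 <= m < N) _.
have term_ge0 m : 0 <= (if n == (k * m)%N then
    invsqrt_on P k * invsqrt_on (integer_over (below k.+1)) m else 0) :> R.
  by case: ifP => // _; rewrite mulr_ge0 ?invsqrt_on_ge0.
have T0 : 0 <= T by apply: sumr_ge0.
have [nk1|nk1] := pselect (integer_over (below k.+1) n); last first.
  by rewrite invsqrt_onF // addr_ge0 ?invsqrt_on_ge0.
have [nk|nk] := pselect (integer_over (below k) n).
  by rewrite !invsqrt_onT // lerDl.
rewrite (invsqrt_onF _ _ _ nk) add0r.
have [n0 nP] := nk1.
have [Pk kn] : P k /\ (k %| n)%N.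
  apply: contrapT => nPk; apply: nk; split=> // p p_pr pn.
  have [Pp] := nP p p_pr pn; rewrite /= ltnS leq_eqVlt => /orP[/eqP pk|//].
  by exfalso; apply: nPk; rewrite -pk.
have k_pr := P_prime _ Pk.
have nE : n = (k * (n %/ k))%N by rewrite mulnC divnK.
have mN : (n %/ k < N)%N by apply: leq_ltn_trans nN; exact: leq_div.
have Pm : integer_over (below k.+1) (n %/ k).
  split=> [|p p_pr pm]; first by rewrite divn_gt0 ?prime_gt0 // dvdn_leq.
  by apply: nP => //; apply: dvdn_trans pm (dvdn_div kn).
apply: (@le_trans _ _ (if n == (k * (n %/ k))%N then
    invsqrt_on P k * invsqrt_on (integer_over (below k.+1)) (n %/ k) else 0)).
  by rewrite -nE eqxx !invsqrt_onT // {1}nE natrM sqrtrM // invfM.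
rewrite /T big_mkord (bigD1 (Ordinal mN)) //= lerDl.
by apply: sumr_ge0 => i _; exact: term_ge0.
Qed.

(** Sum the pointwise bound and exchange the two sums: each [m] contributes to the single index
    [k * m], and only if this is below [N]. Solving for [S k.+1 N] would give the Euler factor of
    [k]. *)
Lemma invsqrt_on_sum_peel k N : S k.+1 N <= S k N + invsqrt_on P k * S k.+1 N.
Proof.
rewrite {1}/S big_nat; apply: (@le_trans _ _ (\sum_(0 <= n < N)
   (invsqrt_on (integer_over (below k)) n +
    \sum_(0 <= m < N) (if n == (k * m)%N then
      invsqrt_on P k * invsqrt_on (integer_over (below k.+1)) m else 0)))).
  by rewrite [leRHS]big_nat; apply: ler_sum => n nN; exact: invsqrt_on_peel.
rewrite big_split /= lerD2l exchange_big /= mulr_sumr; apply: ler_sum => m _.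
by rewrite -big_mkcond big_nat1_eq /=; case: ifP => // _;
  rewrite mulr_ge0 ?invsqrt_on_ge0.
Qed.

(** Every prime is at least 2, and 2 exceeds the square 16/9 of 4/3. This keeps the Euler factors
    bounded. *)
Lemma invsqrt_on_prime_le k : invsqrt_on P k <= 3 / 4 :> R.
Proof.
have [Pk|Pk] := pselect (P k); last by rewrite invsqrt_onF //; lra.
have k2 : (2 : R) <= k%:R by rewrite ler_nat prime_gt1 ?P_prime.
have s : 4 / 3 <= Num.sqrt (k%:R : R).
  have -> : 4 / 3 = Num.sqrt ((4 / 3) ^+ 2) :> R by rewrite sqrtr_sqr ger0_norm; lra.
  by rewrite ler_sqrt; nra.
rewrite invsqrt_onT // -[3 / 4]invrK lef_pV2 ?posrE; lra.
Qed.

(** Induction on the bound [k] on the allowed primes: for [x] in [0, 3/4], an Euler factor satisfies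
    1/(1 - x) <= 1 + 4x <= exp(4x). *)
Lemma integers_over_sum_le N :
  \sum_(0 <= n < N) invsqrt_on (integer_over P) n <=
    expR (4 * \sum_(0 <= p < N) invsqrt_on P p) :> R.
Proof.
(* A prime factor of a positive [n < N] is itself below [N], so restricting the primes to those
   below [N] loses nothing. *)
have SE : \sum_(0 <= n < N) invsqrt_on (integer_over P) n = S N N.
  rewrite /S !big_nat; apply: eq_bigr => n /= nN; rewrite /invsqrt_on.
  congr (if _ then _ else _); apply/asboolP/asboolP => -[n0 nP]; split=> // p p_pr pn.
    split; first exact: nP.
    by apply: leq_ltn_trans (dvdn_leq n0 pn) nN.
  by have [] := nP p p_pr pn.
rewrite SE; elim: {1 3}N => [|k IH].
  rewrite big_geq // mulr0 expR0 /S.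
  (* With no prime allowed, only [n = 1] contributes. *)
  apply: (@le_trans _ _ (\sum_(0 <= n < N | n == 1%N) 1)).
    rewrite [leRHS]big_mkcond; apply: ler_sum => n _.
    have [[n0 nP]|?] := pselect (integer_over (below 0) n); last first.
      by rewrite invsqrt_onF //; case: ifP.
    suff -> : n = 1%N.
      by rewrite invsqrt_onT ?sqrtr1 ?invr1 //; exact: integer_over1.
    apply/eqP; rewrite eqn_leq n0 andbT leqNgt; apply/negP => /pdiv_prime pr.
    by have [] := nP _ pr (pdiv_dvd n).
  by rewrite big_nat1_eq; case: ifP.
rewrite big_nat_recr //= mulrDr expRD.
have S0 : 0 <= S k.+1 N by apply: sumr_ge0 => n _; exact: invsqrt_on_ge0.
have x0 := invsqrt_on_ge0 R P k.
have := invsqrt_on_sum_peel k N; have := invsqrt_on_prime_le k.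
have := expR_ge1Dx (4 * invsqrt_on P k : R).
have := expR_gt0 (4 * \sum_(0 <= p < k) invsqrt_on P p : R).
move: IH x0 S0; set x := invsqrt_on P k; set s1 := S k.+1 N; set s := S k N.
set e := expR _; set y := expR _ => IH x0 S0 e0 yx x34 peel.
(* Multiply [s1 * (1 - x) <= s] by [1 + 4 * x] and use (1 - x)(1 + 4x) = 1 + x(3 - 4x) >= 1. *)
have s1s : s1 <= s * (1 + 4 * x).
  have : 0 <= (s + x * s1 - s1) * (1 + 4 * x) by apply: mulr_ge0; lra.
  have : 0 <= s1 * (x * (3 - 4 * x)) by rewrite !mulr_ge0 //; lra.
  lra.
have : s * (1 + 4 * x) <= e * (1 + 4 * x) by rewrite ler_wpM2r //; lra.
have : e * (1 + 4 * x) <= e * y by rewrite ler_wpM2l // ltW.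
lra.
Qed.

End IntegersOverSum.

(** * General measure estimates *)

Lemma measure_bigcup_le (d : measure_display) (T : measurableType d)
    (R : realType) (mu : {measure set T -> \bar R}) (F : nat -> set T)
    (u : nat -> R) (K : R) :
    (forall i, measurable (F i)) -> (forall i, (mu (F i) <= (u i)%:E)%E) ->
    (forall N, \sum_(0 <= i < N) u i <= K) ->
  (mu (\bigcup_i F i) <= K%:E)%E.
Proof.
move=> mF Fu uK.
apply: (@le_trans _ _ (\sum_(0 <= i <oo) mu (F i))%E).
  by apply: measure_sigma_subadditive => //; apply: bigcup_measurable => i _; exact: mF.
apply: lime_le; first by apply: is_cvg_nneseries => i _ _; exact: measure_ge0.
apply: nearW => N; apply: (@le_trans _ _ (\sum_(0 <= i < N) (u i)%:E)%E).
  exact: lee_sum.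
by rewrite sumEFin lee_fin.
Qed.

(** Centring an interval of radius [r] at any point of [E] covers [E]; the factor 2 is the price for
    not using its infimum and supremum. *)
Lemma lebesgue_measure_diam_le (R : realType)
    (E : set (measurableTypeR R)) (r : R) :
    measurable E -> 0 <= r ->
    (forall x y : R, E x -> E y -> x <= y -> y - x <= r) ->
  (lebesgue_measure E <= (2 * r)%:E)%E.
Proof.
move=> mE r0 Er; have [->|/set0P[x Ex]] := eqVneq E set0.
  by rewrite measure0 lee_fin mulr_ge0.
apply: (@le_trans _ _ (lebesgue_measure (`[x - r, x + r]%classic : set R))).
  apply: le_measure; [exact: mem_set|by apply: mem_set; exact: measurable_itv|].
  move=> y Ey; rewrite /= in_itv /=.
  by case: (leP x y) => [xy|/ltW yx]; apply/andP; split;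
    [|have := Er _ _ Ex Ey xy|have := Er _ _ Ey Ex yx|]; lra.
rewrite lebesgue_measure_itv /=; case: ifP => _; last by rewrite lee_fin mulr_ge0.
by rewrite -EFinB lee_fin; lra.
Qed.

Lemma countable_int (R : realType) : countable [set a : R | a \is a Num.int].
Proof.
apply: (@sub_countable _ _ _ [set: int]); last exact: countableP.
apply: card_le_trans (card_image_le (fun z : int => z%:~R) [set: int]).
by apply: subset_card_le => a /= /intrP[z ->]; exists z.
Qed.

(** * Measure of the bad set inside a window *)

Section Collisions.
Import numFieldNormedType.Exports.
Context {R : realType} (P : set nat).

Definition near_collision (j n m : nat) : set (measurableTypeR R) :=
  [set a | [/\ integer_over P n, integer_over P m &
    `|n%:R * a ^+ j.+1 - m%:R| < 1]].

(** The endpoints are chosen so that the square root of the upper one is [2 * q], which is the lower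
    one divided by [q]; this ratio produces the decay in [j]. *)
Definition window (q : R) : set R := `[2 * q ^+ 2, 4 * q ^+ 2]%classic.

Definition collisions := \bigcup_j \bigcup_n \bigcup_m near_collision j n m.

Lemma measurable_near_collision j n m : measurable (near_collision j n m).
Proof.
have [[Pn Pm]|nPnm] := pselect (integer_over P n /\ integer_over P m); last first.
  rewrite (_ : near_collision j n m = set0) // -subset0 => a [Pn Pm _].
  exact: nPnm.
rewrite (_ : near_collision j n m =
    (fun a : R => `|n%:R * a ^+ j.+1 - m%:R|) @^-1` [set x | x < 1]); last first.
  by apply/seteqP; split=> a; [case|move=> /= ?; split].
apply: measurable_realfun.open_measurable.
have cf : continuous (fun a : R => `|n%:R * a ^+ j.+1 - m%:R| : R).
  move=> a; apply: cvg_norm; apply: cvgB; last exact: cvg_cst.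
  by apply: cvgM; [exact: cvg_cst|exact: exprn_continuous].
by move/continuousP: cf; apply; exact: open_lt.
Qed.

Lemma measurable_collisions : measurable collisions.
Proof.
do 3 (apply: bigcup_measurable => ? _).
exact: measurable_near_collision.
Qed.

Lemma power_gapsE : [set a : R | power_gaps P a] = ~` collisions.
Proof.
apply/seteqP; split=> a /=.
  by move=> ga [j _ [n _ [m _ [Pn Pm]]]]; rewrite ltNge ga.
move=> nc j n m Pn Pm; rewrite leNgt; apply/negP => lt1; apply: nc.
by exists j => //; exists n => //; exists m.
Qed.

(** Both [n%:R * x ^+ j.+1] and [n%:R * y ^+ j.+1] are within 1 of [m], hence within 2 of each
    other, while the power grows at rate at least [(2 * q ^+ 2) ^+ j] on the window. *)
Lemma near_collision_diam (q : R) j n m (x y : R) : 1 <= q ->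
    near_collision j n m x -> near_collision j n m y ->
    2 * q ^+ 2 <= x -> x <= y ->
  y - x <= 2 / (n%:R * (2 * q ^+ 2) ^+ j).
Proof.
move=> q1 [[n0 _] _ xm] [_ _ ym] Ax xy; set A := 2 * q ^+ 2 in Ax *.
have n0R : (0 : R) < n%:R by rewrite ltr0n.
have A0 : 0 < A by rewrite /A; nra.
have Aj : 0 < A ^+ j by rewrite exprn_gt0.
rewrite ler_pdivlMr ?mulr_gt0 //.
have xj : A ^+ j <= x ^+ j by rewrite lerXn2r ?nnegrE //; lra.
have yj : x ^+ j <= y ^+ j by rewrite lerXn2r ?nnegrE //; lra.
have : n%:R * ((y - x) * A ^+ j) <= n%:R * (y ^+ j.+1 - x ^+ j.+1).
  rewrite ler_pM2l // !exprS.
  have : (y - x) * A ^+ j <= (y - x) * x ^+ j by rewrite ler_wpM2l // subr_ge0.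
  have : y * x ^+ j <= y * y ^+ j by rewrite ler_wpM2l //; lra.
  lra.
move: xm ym; rewrite !ltr_norml => /andP[? ?] /andP[? ?]; lra.
Qed.

Lemma near_collision_bound (q : R) j n m (x : R) : 1 <= q ->
    near_collision j n m x -> 0 <= x -> x <= 4 * q ^+ 2 ->
  Num.sqrt m%:R <= 4 * q * Num.sqrt n%:R * (2 * q) ^+ j.
Proof.
move=> q1 [[n0 _] _ xm] x0 xB; set Q := (2 * q) ^+ j.
have Q1 : 1 <= Q by rewrite exprn_ege1 //; lra.
have n1 : (1 : R) <= n%:R by rewrite ler1n.
have ns := sqr_sqrtr (ler0n R n); set s := Num.sqrt n%:R in ns *.
have s0 : 0 <= s by rewrite sqrtr_ge0.
have r0 : 0 <= 4 * q * s * Q by rewrite !mulr_ge0 //; lra.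
rewrite -(ger0_norm r0) -sqrtr_sqr ler_sqrt ?sqr_ge0 //.
have xj : x ^+ j.+1 <= (4 * q ^+ 2) ^+ j.+1 by rewrite lerXn2r ?nnegrE //; nra.
have BE : (4 * q ^+ 2) ^+ j.+1 = 4 * (q ^+ 2 * Q ^+ 2).
  have -> : 4 * q ^+ 2 = (2 * q) ^+ 2 by ring.
  by rewrite exprS [X in _ * X]exprAC -/Q; ring.
have : n%:R * x ^+ j.+1 <= n%:R * (4 * (q ^+ 2 * Q ^+ 2)).
  by rewrite ler_pM2l -?BE //; lra.
(* This absorbs the error 1 in [m < n%:R * x ^+ j.+1 + 1]: four times this quantity plus 1 is at
   most sixteen times it. *)
have Z1 : 1 <= n%:R * (q ^+ 2 * Q ^+ 2).
  by rewrite !mulr_ege1 // ?exprn_ege1.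
have -> : (4 * q * s * Q) ^+ 2 = 16 * (n%:R * (q ^+ 2 * Q ^+ 2)).
  by rewrite -ns; ring.
by move: xm; rewrite ltr_norml => /andP[? ?]; lra.
Qed.

Lemma near_collision_measure_le (q : R) j n m : 1 <= q ->
  (lebesgue_measure (near_collision j n m `&` window q)
   <= (16 * q * (q ^+ j)^-1 * invsqrt_on (integer_over P) n *
       invsqrt_on (integer_over P) m)%:E)%E.
Proof.
move=> q1; set E := _ `&` _.
have qj : 0 < q ^+ j by rewrite exprn_gt0; lra.
have [E0|/set0P[x [cx xI]]] := eqVneq E set0.
  rewrite E0 measure0 lee_fin !mulr_ge0 ?invsqrt_on_ge0 // ?invr_ge0 ?(ltW qj) //.
  lra.
have mE : measurable E.
  by apply: measurableI; [exact: measurable_near_collision|exact: measurable_itv].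
have [Pn Pm _] := cx.
have n0 : (0 : R) < n%:R by rewrite ltr0n; case: Pn.
have m0 : (0 : R) < m%:R by rewrite ltr0n; case: Pm.
have A0 : 0 < 2 * q ^+ 2 by nra.
have d0 : 0 < n%:R * (2 * q ^+ 2) ^+ j by rewrite mulr_gt0 // exprn_gt0.
apply: (le_trans (lebesgue_measure_diam_le _ _ (2 / (n%:R * (2 * q ^+ 2) ^+ j)) mE _ _)).
- by rewrite divr_ge0 // ltW.
- move=> y z [cy]; rewrite /window /= in_itv /= => /andP[Ay _] [cz _].
  exact: near_collision_diam q1 cy cz Ay.
move: xI; rewrite /window /= in_itv /= => /andP[Ax xB].
have := near_collision_bound _ _ _ _ _ q1 cx (le_trans (ltW A0) Ax) xB.
rewrite lee_fin !invsqrt_onT //.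
have ns := sqr_sqrtr (ltW n0); have s0 : 0 < Num.sqrt (n%:R : R) by rewrite sqrtr_gt0.
have t0 : 0 < Num.sqrt (m%:R : R) by rewrite sqrtr_gt0.
move: ns s0 t0; set s := Num.sqrt n%:R; set t := Num.sqrt m%:R => ns s0 t0.
rewrite -ns (_ : 2 * q ^+ 2 = 2 * q * q); last by ring.
rewrite [(2 * q * q) ^+ j]exprMn; set Q := (2 * q) ^+ j.
have Q0 : 0 < Q by rewrite exprn_gt0; lra.
move: qj; set r := q ^+ j => r0 tb.
(* Over a common denominator, the diameter bound and the target differ only in their numerators,
   which [tb] compares. *)
have -> : 2 * (2 / (s ^+ 2 * (Q * r))) = (4 * t) / (s ^+ 2 * Q * r * t).
  by field; rewrite !gt_eqF.
have -> : 16 * q / r / s / t = (4 * (4 * q * s * Q)) / (s ^+ 2 * Q * r * t).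
  by field; rewrite !gt_eqF.
have D0 : 0 < s ^+ 2 * Q * r * t by rewrite !mulr_gt0 // exprn_gt0.
by rewrite ler_pM2r ?invr_gt0 //; lra.
Qed.

Lemma sum_geometric_le2 (r : R) N : 0 <= r -> r <= 1 / 2 ->
  \sum_(0 <= j < N) r ^+ j <= 2.
Proof.
(* The added term bounds the tail of the series and makes the induction close. *)
move=> r0 r2; suff : \sum_(0 <= j < N) r ^+ j + 2 * r ^+ N <= 2.
  by have : 0 <= r ^+ N by [exact: exprn_ge0]; lra.
elim: N => [|N IH]; first by rewrite big_geq // expr0; lra.
rewrite big_nat_recr //= exprS; have rN : 0 <= r ^+ N by exact: exprn_ge0.
have : r * r ^+ N <= 1 / 2 * r ^+ N by rewrite ler_wpM2r.
lra.
Qed.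

(** Three nested union bounds: the sums over [m] and [n] give a factor [C] each, and the geometric
    sum over [j] gives at most 2. *)
Lemma collisions_measure_le (q C : R) : 2 <= q ->
    (forall N, \sum_(0 <= n < N) invsqrt_on (integer_over P) n <= C) ->
  (lebesgue_measure (collisions `&` window q)
   <= (32 * q * C ^+ 2)%:E)%E.
Proof.
move=> q2 wC; set I := window q.
have q1 : 1 <= q by lra.
have C0 : 0 <= C by have := wC 0%N; rewrite big_geq.
have mI : measurable I by exact: measurable_itv.
have w0 n : 0 <= invsqrt_on (integer_over P) n :> R by exact: invsqrt_on_ge0.
have c0 j : 0 <= 16 * q * (q ^+ j)^-1.
  by rewrite !mulr_ge0 ?invr_ge0 ?exprn_ge0 //; lra.
rewrite /collisions setI_bigcupl.
apply: (measure_bigcup_le _ _ _ _ _ (fun j => 16 * q * (q ^+ j)^-1 * C * C)).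
- move=> j; apply: measurableI => //; do 2 (apply: bigcup_measurable => ? _).
  exact: measurable_near_collision.
- move=> j; rewrite setI_bigcupl.
  apply: (measure_bigcup_le _ _ _ _ _
    (fun n => 16 * q * (q ^+ j)^-1 * invsqrt_on (integer_over P) n * C)).
  + move=> n; apply: measurableI => //; apply: bigcup_measurable => ? _.
    exact: measurable_near_collision.
  + move=> n; rewrite setI_bigcupl.
    apply: (measure_bigcup_le _ _ _ _ _ (fun m => 16 * q * (q ^+ j)^-1 *
      invsqrt_on (integer_over P) n * invsqrt_on (integer_over P) m)).
    * by move=> m; apply: measurableI => //; exact: measurable_near_collision.
    * by move=> m; exact: near_collision_measure_le.
    * by move=> N; rewrite -mulr_sumr ler_wpM2l // mulr_ge0.
  + move=> N; rewrite -mulr_suml -mulr_sumr ler_wpM2r // ler_wpM2l //.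
- move=> N; have := sum_geometric_le2 q^-1 N.
  rewrite -[1 / 2]invrK; under eq_bigr do rewrite exprVn; move=> geo.
  rewrite -!mulr_suml -mulr_sumr.
  have {}geo : \sum_(0 <= j < N) (q ^+ j)^-1 <= 2.
    by apply: geo; rewrite ?invr_ge0 ?lef_pV2 ?posrE; lra.
  have : 16 * q * (C * C) * \sum_(0 <= j < N) (q ^+ j)^-1 <= 16 * q * (C * C) * 2.
    by rewrite ler_wpM2l // !mulr_ge0 //; lra.
  lra.
Qed.

End Collisions.

Theorem theorem2 (R : realType) (P : set nat)
    (P_prime : forall p, P p -> prime p)
    (P_summable : (\esum_(p in P) ((Num.sqrt (p%:R : R))^-1)%:E < +oo)%E) :
  (exists a : R, gap_numbers P a) /\
  measurable (gap_numbers P : set (measurableTypeR R)) /\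
  (0 < lebesgue_measure (gap_numbers P : set (measurableTypeR R)))%E.
Proof.
pose Z : set (measurableTypeR R) := [set a : R | a \is a Num.int].
have mZ : measurable Z.
  by apply: countable_measurable (countable_int R) => a; exact: measurable_set1.
have Z0 : lebesgue_measure Z = 0%E.
  by apply: countable_lebesgue_measure0; exact: countable_int.
have gapE : gap_numbers P =
    ~` Z `&` ([set a : R | 1 < a] `&` ~` collisions P) :> set (measurableTypeR R).
  rewrite (gap_numbersE P_prime) -power_gapsE.
  by apply/seteqP; split=> a /= [/negP aZ]; split=> //; exact/negP.
have mgap : measurable (gap_numbers P : set (measurableTypeR R)).
  rewrite gapE; apply: measurableI; first exact: measurableC.
  apply: measurableI; last first.
    by apply: measurableC; exact: measurable_collisions.
  rewrite (_ : [set a : R | 1 < a] = [set` `]1, +oo[ ]); last first.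
    by apply/seteqP; split=> a; rewrite /= in_itv /= andbT.
  exact: measurable_itv.
(* Existence follows from positivity, as the empty set has measure 0. *)
suff gap_pos : (0 < lebesgue_measure (gap_numbers P : set (measurableTypeR R)))%E.
  split=> //; apply: contrapT => /forallNP gap0; move: gap_pos.
  by rewrite (_ : gap_numbers P = set0) ?measure0 ?ltxx // -subset0 => a /gap0.
(* The choice of [q] makes [32 * q * C ^+ 2] smaller than the window length [2 * q ^+ 2]; the
   summand 2 ensures [2 <= q]. *)
pose sigma := (\esum_(p in P) ((Num.sqrt (p%:R : R))^-1)%:E)%E.
pose C := expR (4 * fine sigma); pose q := 16 * C ^+ 2 + 2.
have sigmaE : sigma = (fine sigma)%:E.
  have sigma0 : (0 <= sigma)%E.
    by apply: esum_ge0 => p _; rewrite lee_fin invr_ge0 sqrtr_ge0.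
  by rewrite fineK // ge0_fin_numE.
have wC N : \sum_(0 <= n < N) invsqrt_on (integer_over P) n <= C.
  apply: le_trans (integers_over_sum_le P_prime N) _.
  rewrite ler_expR ler_pM2l // -lee_fin -sigmaE.
  exact: invsqrt_on_le_esum.
have C0 : 0 <= C ^+ 2 by exact: sqr_ge0.
have q2 : 2 <= q by rewrite /q; lra.
have mcw : measurable (collisions P `&` window q).
  by apply: measurableI; [exact: measurable_collisions|exact: measurable_itv].
rewrite lt0e measure_ge0 andbT; apply/eqP => gap0.
(* The window is covered by gap numbers, integers and collisions. The first two being null, its
   length would be at most the measure of the collisions in it, which is too small. *)
have : (lebesgue_measure (window q) <=
    lebesgue_measure ((gap_numbers P `|` Z) `|` (collisions P `&` window q) :
      set (measurableTypeR R)))%E.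
  apply: le_measure.
  - by apply: mem_set; exact: measurable_itv.
  - by apply: mem_set; apply: measurableU => //; exact: measurableU.
  move=> a aw; have [ac|ac] := pselect (collisions P a); first by right.
  left; have [aZ|aZ] := pselect (Z a); [by right|left].
  rewrite gapE; split=> //; split=> //.
  by move: aw; rewrite /window /= in_itv /= => /andP[+ _]; nra.
have gap_le : (lebesgue_measure ((gap_numbers P `|` Z) `|`
    (collisions P `&` window q) : set (measurableTypeR R)) <=
    (32 * q * C ^+ 2)%:E)%E.
  apply: le_trans (collisions_measure_le P q C q2 wC).
  apply: le_trans (measureU2 _ _ mcw) _; first exact: measurableU.
  rewrite -[leRHS]add0e; apply: leeD => //.
  apply: le_trans (measureU2 _ mgap mZ) _.
  by rewrite [X in (X + _)%E]gap0 [X in (_ + X)%E]Z0 adde0.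
move/le_trans/(_ gap_le); rewrite lebesgue_measure_itv /= lte_fin.
by case: ifP => [_|/negbT]; rewrite -?leNgt -?EFinB ?lee_fin /q; nra.
Qed.
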